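(* Let $\rho,\lambda>0$, let $(x_t,y_t,c_t)$, $t\ge0$, be i.i.d. with $(x_t,y_t)\sim d_0$ and $c_t\sim\mathcal{M}(\cdot\mid x_t,y_t)$, and let $w_{t+1}=w_t+\rho\lambda\,s_{\mathrm{FM}}(x_t,y_t,c_t)$, started at $w_0$, where the score $s_{\mathrm{FM}}$ is always the one evaluated at $w_0$. Let $k:=\mathrm{tr}(\Pi)=\dim(S_{\mathrm{low}}(\eta))$. Then for any integer $T\ge1$, $$\mathbb{E}\big[\|\Pi(w_T-w_0)\|_2^2\big]=\rho^2\lambda^2\Big(T\,\mathrm{tr}(\Pi C_{\mathrm{FM}}\Pi)+T^2\,\|\Pi m_{\mathrm{FM}}\|_2^2\Big).$$ In particular, if there are $b_{\mathrm{FM}}>0$ and $\gamma_{\mathrm{FM}}>0$ such that $\|\Pi m_{\mathrm{FM}}\|_2\ge b_{\mathrm{FM}}$ and $\Pi C_{\mathrm{FM}}\Pi\succeq\gamma_{\mathrm{FM}}\Pi$ (positive semidefinite order), then $$\mathbb{E}\big[\|\Pi(w_T-w_0)\|_2^2\big]\ge\rho^2\lambda^2\Big(T\,\gamma_{\mathrm{FM}}\,k+T^2\,b_{\mathrm{FM}}^2\Big).$$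
   Context: Log-linear policy: prompts $x\sim\mu$; for each $x$ a finite response set $\mathcal{Y}(x)$; a shared representation $z_w(x,y)\in\mathbb{R}^d$, differentiable in $w\in\mathbb{R}^p$; a head $b\in\mathbb{R}^d$; inverse temperature $\tau>0$; for $\theta=(b,w)$, $\pi_\theta(y\mid x)\propto\exp(\tau\, b^\top z_w(x,y))$ over $y\in\mathcal{Y}(x)$. Fix an initialization $\theta_0=(b_0,w_0)$ and the frozen rollout distribution $d_0(x,y):=\mu(x)\pi_{\theta_0}(y\mid x)$. Low-signal subspace: let $\mathrm{pass}(x,y)\in\{0,1\}$ be a success indicator with $\varepsilon_0:=\Pr_{d_0}(\mathrm{pass}=1)>0$, let $s^w_w(x,y):=\nabla_w\log\pi_{(b_0,w)}(y\mid x)\in\mathbb{R}^p$ and $\Sigma_{\mathrm{succ}}^w(w_0):=\mathbb{E}_{d_0}[s^w_{w_0}(x,y)s^w_{w_0}(x,y)^\top\mid\mathrm{pass}(x,y)=1]$ (assumed finite), with eigenvalues $\lambda_1\ge\dots\ge\lambda_p\ge0$ and orthonormal eigenbasis $v_1,\dots,v_p$. For $\eta>0$, $S_{\mathrm{low}}(\eta):=\mathrm{span}\{v_i:\lambda_i<\eta\}$ and $\Pi$ is the orthogonal projector of $\mathbb{R}^p$ onto it. Feedback model: $\mathcal{C}$ is a finite set of critique types, $u_\psi(c)\in\mathbb{R}^d$ is an embedding of $c\in\mathcal{C}$ with parameter $\psi$, fixed at $\psi_0$, and $$p_{\psi,w}(c\mid x,y):=\frac{\exp(\langle u_\psi(c),z_w(x,y)\rangle)}{\sum_{c'\in\mathcal{C}}\exp(\langle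 u_\psi(c'),z_w(x,y)\rangle)}.$$ The feedback provider $\mathcal{M}(\cdot\mid x,y)$ is a probability distribution on $\mathcal{C}$ for each $(x,y)$. The feedback-modeling score at initialization is $s_{\mathrm{FM}}(x,y,c):=\nabla_w\log p_{\psi_0,w}(c\mid x,y)\big|_{w=w_0}\in\mathbb{R}^p$. With expectations under $(x,y)\sim d_0$, $c\sim\mathcal{M}(\cdot\mid x,y)$, and assuming $s_{\mathrm{FM}}$ has finite second moment, $$m_{\mathrm{FM}}:=\mathbb{E}[s_{\mathrm{FM}}],\qquad C_{\mathrm{FM}}:=\mathbb{E}\big[(s_{\mathrm{FM}}-m_{\mathrm{FM}})(s_{\mathrm{FM}}-m_{\mathrm{FM}})^\top\big].$$ *)

(* Defs.v *)
From HB Require Import structures.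
From mathcomp Require Import all_boot all_order all_algebra.
From mathcomp Require Import all_classical all_reals all_analysis.
From mathcomp Require Import measurable_realfun.

Set Implicit Arguments.
Unset Strict Implicit.
Unset Printing Implicit Defensive.

Import Order.TTheory GRing.Theory Num.Theory.
Import numFieldNormedType.Exports.

Local Open Scope classical_set_scope.
Local Open Scope ring_scope.

(* Vectors of R^n are columns 'cV[R]_n.  MathComp-Analysis norms matrices by
   the sup norm, so the Euclidean norm is defined separately; differentiability
   does not depend on the choice. *)

Definition dotp (R : realType) (n : nat) (u v : 'cV[R]_n) : R :=
  \sum_(i < n) u i 0 * v i 0.

Definition norm2 (R : realType) (n : nat) (u : 'cV[R]_n) : R :=
  Num.sqrt (dotp u u).

Definition gradient (R : realType) (n : nat) (f : 'cV[R]_n -> R)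
    (w : 'cV[R]_n) : 'cV[R]_n :=
  \col_(i < n) 'D_(delta_mx i 0) f w.

Definition psdmx (R : realType) (n : nat) (A : 'M[R]_n) : Prop :=
  A^T = A /\ forall u : 'cV[R]_n, 0 <= dotp u (A *m u).

Definition loewner_ge (R : realType) (n : nat) (A B : 'M[R]_n) : Prop :=
  psdmx (A - B).

Definition orthogonal_projector (R : realType) (n : nat) (Pi : 'M[R]_n)
    (S : {vspace 'cV[R]_n}) : Prop :=
  forall u : 'cV[R]_n, Pi *m u \in S /\
    (forall s : 'cV[R]_n, s \in S -> dotp s (u - Pi *m u) = 0).

Definition sorted_eigenbasis (R : realType) (n : nat) (A : 'M[R]_n)
    (lam : 'I_n -> R) (v : 'I_n -> 'cV[R]_n) : Prop :=
  [/\ forall i j : 'I_n, dotp (v i) (v j) = (i == j)%:R,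
      forall i : 'I_n, A *m v i = lam i *: v i,
      forall i j : 'I_n, (i <= j)%N -> lam j <= lam i
    & forall i : 'I_n, 0 <= lam i].

Definition low_space (R : realType) (n : nat) (lam : 'I_n -> R)
    (v : 'I_n -> 'cV[R]_n) (eta : R) : {vspace 'cV[R]_n} :=
  <<[seq v i | i <- enum 'I_n & lam i < eta]>>%VS.

(* The joint law mu(dx) k(x, dy) of a pair with first marginal mu and
   conditional law k(x, .) of the second component given the first. *)
Section joint.
Context (d1 d2 : measure_display) (T1 : measurableType d1)
  (T2 : measurableType d2) (R : realType).
Variables (mu : probability T1 R) (k : R.-pker T1 ~> T2).

Definition joint (A : set (T1 * T2)) : \bar R :=
  (\int[mu]_x k x (xsection A x))%E.

Let measurable_section (A : set (T1 * T2)) : measurable A ->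
  measurable_fun [set: T1] (fun x => k x (xsection A x)).
Proof.
move=> mA.
rewrite (_ : (fun x => _) = (fun x => (\int[k x]_y (\1_A (x, y))%:E)%E)).
  apply: (measurable_fun_integral_sfinite_kernel
    (fun xy => (\1_A xy)%:E) k) => //.
  by apply/measurable_EFinP; exact: measurable_indic.
apply/funext => x.
have -> : (fun y => (\1_A (x, y))%:E) = (fun y => (\1_(xsection A x) y)%:E :> \bar R).
  by apply/funext => y; rewrite !indicE mem_xsection.
by rewrite integral_indic ?setIT//; exact: measurable_xsection.
Qed.

Let joint0 : joint set0 = 0%E.
Proof. by apply: integral0_eq => x _; rewrite xsection0 measure0. Qed.

Let joint_ge0 (A : set (T1 * T2)) : (0 <= joint A)%E.
Proof. exact: integral_ge0. Qed.

Let joint_sigma_additive : semi_sigma_additive joint.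
Proof.
move=> A mA tA mUA.
have -> : joint (\bigcup_n A n) = (\sum_(n <oo) joint (A n))%E.
  rewrite /joint -integral_nneseries//; last first.
    by move=> n; exact: measurable_section.
  apply: eq_integral => x _; rewrite xsection_bigcup.
  apply/esym/cvg_lim => //; apply: measure_semi_sigma_additive.
  - by move=> n; exact: measurable_xsection.
  - exact: trivIset_xsection.
  - by apply: bigcup_measurable => n _; exact: measurable_xsection.
exact: is_cvg_nneseries.
Qed.

HB.instance Definition _ := isMeasure.Build _ _ _ joint
  joint0 joint_ge0 joint_sigma_additive.

Let joint_setT : joint setT = 1%E.
Proof.
rewrite /joint (eq_integral (cst 1%E)); last first.
  by move=> x _; rewrite -setXTT in_xsectionX ?inE//= prob_kernel.
by rewrite integral_cst// [X in (_ * X)%E]probability_setT mule1.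
Qed.

HB.instance Definition _ :=
  Measure_isProbability.Build _ _ _ joint joint_setT.

Definition joint_law : probability (T1 * T2)%type R := joint.

End joint.

Section probability_notions.
Context (d d' : measure_display) (T : measurableType d)
  (T' : measurableType d') (R : realType) (P : probability T R).

Definition cond_expectation (A : set T) (f : T -> R) : R :=
  (\int[P]_(x in A) f x) / fine (P A).

Definition cond_second_moment (n : nat) (A : set T)
    (s : T -> 'cV[R]_n) : 'M[R]_n :=
  \matrix_(i < n, j < n) cond_expectation A (fun x => (s x *m (s x)^T) i j).

Definition mean_vector (n : nat) (s : T -> 'cV[R]_n) : 'cV[R]_n :=
  \col_(i < n) \int[P]_x s x i 0.

Definition covariance_matrix (n : nat) (s : T -> 'cV[R]_n) : 'M[R]_n :=
  let m := mean_vector s in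
  \matrix_(i < n, j < n)
    \int[P]_x (((s x - m) *m (s x - m)^T) i j).

Definition finite_second_moment (n : nat) (s : T -> 'cV[R]_n) : Prop :=
  P.-integrable setT (fun x => (norm2 (s x) ^+ 2)%:E).

Definition mutually_independent (Z : nat -> {RV P >-> T'}) : Prop :=
  forall (J : seq nat) (A : nat -> set T'), uniq J ->
    (forall t, measurable (A t)) ->
    P (\bigcap_(t in [set` J]) Z t @^-1` A t) =
    (\prod_(t <- J) P (Z t @^-1` A t))%E.

Definition iid (Z : nat -> {RV P >-> T'}) (Q : probability T' R) : Prop :=
  mutually_independent Z /\
  forall (t : nat) (A : set T'), measurable A -> distribution P (Z t) A = Q A.

End probability_notions.

Section model.
Context (dX dY dC : measure_display) (X : measurableType dX)
  (Y : measurableType dY) (C : measurableType dC) (R : realType) (p d : nat).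
Variables (resp : X -> set Y) (z : 'cV[R]_p -> X -> Y -> 'cV[R]_d).

(* Only meaningful for y in resp x. *)
Definition policy (tau : R) (b : 'cV[R]_d) (w : 'cV[R]_p) (x : X) (y : Y) : R :=
  expR (tau * dotp b (z w x y)) /
  \sum_(y' \in resp x) expR (tau * dotp b (z w x y')).

(* k(x, .) is the law on the finite set resp x with probability mass function
   policy tau b w x.  Taking k of kernel type records that the policy depends
   measurably on x. *)
Definition is_policy_kernel (tau : R) (b : 'cV[R]_d) (w : 'cV[R]_p)
    (k : R.-pker X ~> Y) : Prop :=
  forall (x : X) (B : set Y), measurable B ->
    k x B = (\sum_(y \in resp x `&` B) policy tau b w x y)%:E.

Definition policy_score (tau : R) (b : 'cV[R]_d) (w : 'cV[R]_p)
    (xy : X * Y) : 'cV[R]_p :=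
  gradient (fun w' => ln (policy tau b w' xy.1 xy.2)) w.

Definition feedback_prob (Psi : Type) (u : Psi -> C -> 'cV[R]_d) (psi : Psi)
    (w : 'cV[R]_p) (x : X) (y : Y) (c : C) : R :=
  expR (dotp (u psi c) (z w x y)) /
  \sum_(c' \in [set: C]) expR (dotp (u psi c') (z w x y)).

Definition feedback_score (Psi : Type) (u : Psi -> C -> 'cV[R]_d) (psi : Psi)
    (w : 'cV[R]_p) (xyc : X * Y * C) : 'cV[R]_p :=
  gradient (fun w' => ln (feedback_prob u psi w' xyc.1.1 xyc.1.2 xyc.2)) w.

End model.

Fixpoint iterates (S : Type) (R : realType) (p : nat) (step : R)
    (s : S -> 'cV[R]_p) (w0 : 'cV[R]_p) (zeta : nat -> S) (t : nat) : 'cV[R]_p :=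
  if t is t'.+1 then iterates step s w0 zeta t' + step *: s (zeta t') else w0.

(* Main.v *)
(** Since the score is frozen at [w0], the displacement [w_T - w0] is
    [rho * lambda] times a sum of T i.i.d. vectors.  Each coordinate of
    [Pi s] is a square-integrable real variable f, and expanding the square,
    with E[f(Z_i) f(Z_j)] = m^2 off the diagonal, gives
    E[(sum f(Z_t))^2] = T Var f + T^2 m^2; summing over the coordinates yields
    the trace of [Pi C Pi] and the norm of [Pi m].  The lower bound uses
    tr Pi = k and the fact that a positive semidefinite matrix has nonnegative
    trace. *)

Require Import Defs.
From HB Require Import structures.
From mathcomp Require Import all_boot all_order all_algebra.
From mathcomp Require Import all_classical all_reals all_analysis.
From mathcomp Require Import measurable_realfun.
From mathcomp Require Import ring.

Set Implicit Arguments.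
Unset Strict Implicit.
Unset Printing Implicit Defensive.

Import Order.TTheory GRing.Theory Num.Theory.
Import numFieldNormedType.Exports.

Local Open Scope classical_set_scope.
Local Open Scope ring_scope.

(** * Orthogonal projectors on spans of orthonormal families *)

Section linear_algebra.
Context {R : realType} {n : nat}.
Implicit Types (u v : 'cV[R]_n) (A Pi : 'M[R]_n).

Lemma dotpE u v : dotp u v = (u^T *m v) 0 0.
Proof. by rewrite mxE; apply: eq_bigr => i _; rewrite mxE. Qed.

Lemma dotpC u v : dotp u v = dotp v u.
Proof. by apply: eq_bigr => i _; rewrite mulrC. Qed.

Lemma dotp_ge0 u : 0 <= dotp u u.
Proof. by apply: sumr_ge0 => i _; rewrite -expr2 sqr_ge0. Qed.

Lemma dotp_eq0 u : dotp u u = 0 -> u = 0.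
Proof.
move=> /eqP; rewrite psumr_eq0 => [/allP u0|i _]; last by rewrite -expr2 sqr_ge0.
apply/matrixP => i j; rewrite (ord1 j) mxE; apply/eqP.
by move: (u0 i); rewrite mem_index_enum mulf_eq0 orbb; apply.
Qed.

Lemma norm2_sqr u : norm2 u ^+ 2 = \sum_(i < n) u i 0 ^+ 2.
Proof. by rewrite sqr_sqrtr ?dotp_ge0//; apply: eq_bigr => i _; rewrite expr2. Qed.

Lemma dotp_delta_mulmx A i : dotp (delta_mx i 0) (A *m delta_mx i 0) = A i i.
Proof.
rewrite dotpE mulmxA trmx_delta -rowE -colE !mxE//.
Qed.

(** Every diagonal entry is the quadratic form of [A] at a standard basis vector. *)
Lemma psdmx_mxtrace_ge0 A : psdmx A -> 0 <= \tr A.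
Proof. by case=> _ A0; apply: sumr_ge0 => i _; rewrite -dotp_delta_mulmx. Qed.

End linear_algebra.

Section orthogonal_projectors.
Context {R : realType} {n : nat}.
Implicit Types (u v w : 'cV[R]_n) (a : R).

Lemma dotpDl u v w : dotp (u + v) w = dotp u w + dotp v w.
Proof. by rewrite !dotpE linearD mulmxDl mxE. Qed.

Lemma dotpBl u v w : dotp (u - v) w = dotp u w - dotp v w.
Proof. by rewrite !dotpE linearB mulmxBl !mxE. Qed.

Lemma dotpBr u v w : dotp u (v - w) = dotp u v - dotp u w.
Proof. by rewrite dotpC dotpBl -!(dotpC u). Qed.

Lemma dotpZl a u v : dotp (a *: u) v = a * dotp u v.
Proof. by rewrite !dotpE linearZ -scalemxAl mxE. Qed.

Lemma dotpZr a u v : dotp u (a *: v) = a * dotp u v.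
Proof. by rewrite dotpC dotpZl dotpC. Qed.

Lemma dotp_suml (J : Type) (s : seq J) (F : J -> 'cV[R]_n) w :
  dotp (\sum_(j <- s) F j) w = \sum_(j <- s) dotp (F j) w.
Proof.
elim: s => [|j s IHs]; last by rewrite !big_cons dotpDl IHs.
by rewrite !big_nil /dotp big1 // => i _; rewrite mxE mul0r.
Qed.

Lemma dotp_sumr (J : Type) (s : seq J) (F : J -> 'cV[R]_n) w :
  dotp w (\sum_(j <- s) F j) = \sum_(j <- s) dotp w (F j).
Proof. by rewrite dotpC dotp_suml; apply: eq_bigr => j _; rewrite dotpC. Qed.

Lemma mulmx_trmx_dotp u v w : u *m v^T *m w = dotp v w *: u.
Proof.
apply/matrixP => i j; rewrite (ord1 j) -mulmxA mxE big_ord1.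
by rewrite [RHS]mxE dotpE mulrC.
Qed.

Context (I : eqType) (v : I -> 'cV[R]_n).
Hypothesis v_on : forall i j, dotp (v i) (v j) = (i == j)%:R.

Lemma dotp_orthonormal_sum (s : seq I) (c : I -> R) j : uniq s -> j \in s ->
  dotp (v j) (\sum_(i <- s) c i *: v i) = c j.
Proof.
move=> us js; rewrite dotp_sumr (bigD1_seq j)//= dotpZr v_on eqxx mulr1 big1 ?addr0//.
by move=> i /negPf ij; rewrite dotpZr v_on eq_sym ij mulr0.
Qed.

(** Pairing a vanishing combination with [v j] isolates its [j]-th coefficient. *)
Lemma orthonormal_free (s : seq I) : uniq s -> free [seq v i | i <- s].
Proof.
move=> us; apply/(@freeP _ _ _ (map_tuple v (in_tuple s))) => k k0 j.
pose x0 := tnth (in_tuple s) j.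
(* [freeP] indexes coefficients by position and the orthonormal sum by element; [c] translates
   through [index]. The default [j] of [insubd] is never reached, since [index i s < size s] for [i]
   in [s]. *)
pose c i := k (insubd j (index i s)).
have := @dotp_orthonormal_sum s c x0 us (mem_tnth _ _).
have sE : \sum_(i <- s) c i *: v i = 0.
  rewrite (big_tnth _ _ s) -[RHS]k0; apply: eq_bigr => i _.
  rewrite (nth_map x0)//= (tnth_nth x0)/= /c index_uniq//; congr (k _ *: _).
  by apply: val_inj; rewrite val_insubd ltn_ord.
rewrite sE /dotp big1 => [|i _]; last by rewrite mxE mulr0.
rewrite /c /x0 (tnth_nth x0) index_uniq//= => {1}->.
by congr k; apply: val_inj; rewrite val_insubd ltn_ord.
Qed.

(** Both [Pi *m u] and the orthonormal expansion [q] of [u] lie in the span and differ from [u] by a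
    vector orthogonal to it. Their difference is therefore in the span and orthogonal to itself,
    hence zero. *)
Lemma orthogonal_projector_span Pi (s : seq I) : uniq s ->
  orthogonal_projector Pi <<[seq v i | i <- s]>>%VS ->
  Pi = \sum_(i <- s) v i *m (v i)^T.
Proof.
move=> us PiP.
have PiE u : Pi *m u = \sum_(i <- s) dotp (v i) u *: v i.
  have [PiS Piorth] := PiP u.
  set q := RHS.
  have qS : q \in <<[seq v i | i <- s]>>%VS.
    rewrite /q big_seq memv_suml// => i si; apply: memvZ; apply: memv_span.
    exact: map_f.
  have rS : Pi *m u - q \in <<[seq v i | i <- s]>>%VS by rewrite memvB.
  apply/eqP; rewrite -subr_eq0; apply/eqP/dotp_eq0.
  (* [Pi *m u] may be traded for [u] in the second factor, because [u - Pi *m u] is orthogonal to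
     the span. Expanding the first factor over the family then leaves terms in [dotp (v i) (u - q)],
     all zero. *)
  have -> : dotp (Pi *m u - q) (Pi *m u - q) = dotp (Pi *m u - q) (u - q).
    have e : Pi *m u - q = u - q - (u - Pi *m u).
      by rewrite opprB [RHS]addrC addrA subrK.
    by rewrite [X in dotp _ X = _]e dotpBr Piorth ?subr0.
  move: rS => /(coord_span (X := map_tuple v (in_tuple s))) ->.
  rewrite dotp_suml big1// => i _; rewrite dotpZl.
  rewrite (nth_map (tnth (in_tuple s) i))//= dotpBr dotp_orthonormal_sum//.
    by rewrite subrr mulr0.
  exact: mem_nth.
apply/matrixP => i j.
have /matrixP/(_ i 0) := PiE (delta_mx j 0).
rewrite -colE mxE => ->; rewrite !summxE; apply: eq_bigr => k _.
by rewrite -mulmx_trmx_dotp -colE mxE.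
Qed.

(** Each rank-one term [v i *m (v i)^T] has trace [dotp (v i) (v i) = 1], and the number of terms is
    the dimension because the family is free. *)
Lemma mxtrace_orthogonal_projector_span Pi (s : seq I) : uniq s ->
  orthogonal_projector Pi <<[seq v i | i <- s]>>%VS ->
  \tr Pi = (\dim <<[seq v i | i <- s]>>%VS)%:R.
Proof.
move=> us /(orthogonal_projector_span us) ->.
have /eqP -> := orthonormal_free us.
rewrite raddf_sum/= size_map (eq_bigr (fun=> 1)) => [|i _].
  by rewrite big_const_seq count_predT iter_addr addr0.
rewrite mxtrace_mulC /mxtrace big_ord1 -dotpE v_on eqxx//.
Qed.

Lemma trmx_orthogonal_projector_span Pi (s : seq I) : uniq s ->
  orthogonal_projector Pi <<[seq v i | i <- s]>>%VS -> Pi^T = Pi.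
Proof.
move=> us /(orthogonal_projector_span us) ->.
by rewrite linear_sum/=; apply: eq_bigr => i _; rewrite trmx_mul trmxK.
Qed.

End orthogonal_projectors.

(** * Second moments of sums of i.i.d. variables *)

(** Tonelli applied to [|f| |g|] gives a product of two finite integrals, hence integrability;
    Fubini then factors the signed integral in the same way. *)
Lemma RintegralM_prod d1 d2 (T1 : measurableType d1) (T2 : measurableType d2)
    (R : realType) (P1 : probability T1 R) (P2 : probability T2 R)
    (f : T1 -> R) (g : T2 -> R) :
  P1.-integrable setT (EFin \o f) -> P2.-integrable setT (EFin \o g) ->
  (P1 \x P2)%E.-integrable setT (EFin \o (fun xy => f xy.1 * g xy.2)) /\
  \int[(P1 \x P2)%E]_xy (f xy.1 * g xy.2) = (\int[P1]_x f x) * (\int[P2]_y g y).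
Proof.
move=> If Ig.
have mf : measurable_fun setT f by apply/measurable_EFinP; exact: measurable_int If.
have mg : measurable_fun setT g by apply/measurable_EFinP; exact: measurable_int Ig.
have mfg : measurable_fun setT (EFin \o (fun xy : T1 * T2 => f xy.1 * g xy.2)).
  apply/measurable_EFinP; apply: measurable_funM.
    exact: (measurableT_comp mf measurable_fst).
  exact: (measurableT_comp mg measurable_snd).
have Ifg : (P1 \x P2)%E.-integrable setT (EFin \o (fun xy => f xy.1 * g xy.2)).
  apply/integrable12ltyP => //=.
  under eq_integral => x _.
    under eq_integral => y _ do rewrite normrM EFinM.
    rewrite ge0_integralZl//; last first.
      by apply/measurable_EFinP; exact: measurableT_comp.
    over.
  rewrite /=.
  have /integrableP[_ If'] := If; have /integrableP[_ Ig'] := Ig.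
  (* Once known to be finite, the inner integral is a real constant that can leave the outer one. *)
  have Ig2 : (\int[P2]_y `|g y|%:E)%E \is a fin_num.
    by rewrite ge0_fin_numE// integral_ge0.
  rewrite -(fineK Ig2).
  rewrite ge0_integralZr//.
  - by rewrite muleC; apply: lte_mul_pinfty => //; rewrite lee_fin fine_ge0// integral_ge0.
  - by apply/measurable_EFinP; exact: measurableT_comp.
  - by rewrite lee_fin fine_ge0// integral_ge0.
split=> //.
rewrite /Rintegral -integral12_prod_meas1// /fubini_F/=.
under eq_integral => x _.
  under eq_integral => y _ do rewrite EFinM.
  rewrite integralZl//.
  over.
rewrite /=.
rewrite -(fineK (integrable_fin_num measurableT Ig)).
by rewrite integralZr// fineM// ?integrable_fin_num.
Qed.

(** Integrability is proved together with the formula because additivity at each induction step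
    requires the tail sum to be integrable. *)
Lemma Rintegral_sum d (T : measurableType d) (R : realType)
    (mu : {measure set T -> \bar R}) (D : set T) (I : Type) (s : seq I)
    (F : I -> T -> R) : measurable D ->
  (forall i, mu.-integrable D (EFin \o F i)) ->
  mu.-integrable D (EFin \o (fun x => \sum_(i <- s) F i x)) /\
  \int[mu]_(x in D) (\sum_(i <- s) F i x) =
    \sum_(i <- s) \int[mu]_(x in D) F i x.
Proof.
move=> mD IF; elim: s => [|i s [Is IHs]].
  rewrite (_ : (fun _ => _) = fun=> 0) ?big_nil; last first.
    by apply/funext => x; rewrite big_nil.
  by split; [exact: integrable0|rewrite Rintegral_cst// mul0r].
rewrite (_ : (fun _ => _) = fun x => F i x + \sum_(j <- s) F j x); last first.
  by apply/funext => x; rewrite big_cons.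
split; last by rewrite RintegralD// big_cons IHs.
by apply: (eq_integrable mD _ _ _ (integrableD mD (IF i) Is)).
Qed.

Section square_integrable.
Context {d : measure_display} {T : measurableType d} {R : realType}.
Variable P : probability T R.
Implicit Types f : T -> R.

Lemma integrable_cst_probability (c : R) : P.-integrable setT (EFin \o cst c).
Proof. exact: finite_measure_integrable_cst. Qed.

(** The bound [|f| <= 1 + f ^+ 2] suffices, constants being integrable for a probability. *)
Lemma integrable_of_sqr f : measurable_fun setT f ->
  P.-integrable setT (EFin \o (fun x => f x ^+ 2)) ->
  P.-integrable setT (EFin \o f).
Proof.
move=> mf If2; apply: (@le_integrable _ _ _ _ _ _ _
  (fun x => (1%R + f x ^+ 2)%:E)) => //.
- exact/measurable_EFinP.
- move=> x _ /=; rewrite lee_fin [leRHS]ger0_norm; last first.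
    by rewrite addr_ge0// sqr_ge0.
  rewrite -(real_normK (num_real (f x))).
  have [f1|/ltW f1] := leP `|f x| 1.
    by rewrite (le_trans f1)// lerDl sqr_ge0.
  by rewrite expr2 (le_trans (ler_peMr _ f1))// lerDr.
- by apply: (eq_integrable measurableT _ _ _
    (integrableD measurableT (integrable_cst_probability 1) If2)).
Qed.

Lemma Rintegral_sqrB_mean f : P.-integrable setT (EFin \o f) ->
  P.-integrable setT (EFin \o (fun x => f x ^+ 2)) ->
  \int[P]_x (f x - \int[P]_y f y) ^+ 2 =
    \int[P]_x f x ^+ 2 - (\int[P]_x f x) ^+ 2.
Proof.
move=> If If2; set m := \int[P]_y f y.
have Imf : P.-integrable setT (EFin \o (fun x => (2 * m) * f x)).
  by apply: (eq_integrable measurableT _ _ _ (integrableZl measurableT _ If)).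
have Im := integrable_cst_probability (m ^+ 2).
transitivity (\int[P]_x (f x ^+ 2 - 2 * m * f x + m ^+ 2)).
  by apply: eq_Rintegral => x _; ring.
rewrite RintegralD ?RintegralB ?RintegralZl ?Rintegral_cst//=.
- rewrite probability_setT/= -/m; ring.
- exact: (integrable_cst_probability m).
- by apply: (eq_integrable measurableT _ _ _ (integrableB measurableT If2 Imf)).
Qed.

End square_integrable.

Section iid.
Context {d d' : measure_display} {T : measurableType d} {T' : measurableType d'}
  {R : realType} {P : probability T R} {Z : nat -> {RV P >-> T'}}
  {Q : probability T' R}.
Hypothesis Z_iid : iid Z Q.

(** Change of variables along [Z t], whose law is [Q]. *)
Lemma iid_integrable_comp t (f : T' -> R) :
  Q.-integrable setT (EFin \o f) -> P.-integrable setT (EFin \o (f \o Z t)).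
Proof.
move=> If; apply/integrableP; have /integrableP[mf Ifoo] := If; split.
  exact: (measurableT_comp mf).
move: Ifoo.
rewrite -(eq_measure_integral _ (fun A mA _ => Z_iid.2 t A mA)).
rewrite ge0_integral_pushforward//.
by apply: measurableT_comp.
Qed.

Lemma iid_Rintegral_comp t (f : T' -> R) : Q.-integrable setT (EFin \o f) ->
  \int[P]_w f (Z t w) = \int[Q]_x f x.
Proof.
move=> If; rewrite /Rintegral.
rewrite -(eq_measure_integral _ (fun A mA _ => Z_iid.2 t A mA)).
rewrite integral_pushforward//.
  exact: measurable_int If.
exact: iid_integrable_comp.
Qed.

(* Independence enters only here: the joint law of two distinct samples is a
   product measure, so Fubini's theorem factors mixed moments. *)
Let pair_law (t1 t2 : nat) : t1 != t2 ->
  forall A : set (T' * T'), measurable A ->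
  (Q \x Q)%E A = pushforward P (fun w => (Z t1 w, Z t2 w)) A.
Proof.
move=> t12 A mA; have mZ : measurable_fun setT (fun w => (Z t1 w, Z t2 w)).
  by apply/measurable_fun_pairP; split => //=.
pose Z12 : {RV P >-> (T' * T')%type} := mfun_Sub (mem_set mZ).
pose m : probability (T' * T')%type R := distribution P Z12.
apply: (@product_measure_unique _ _ _ _ _ Q Q m _ A mA) => {A mA} A B mA mB.
change (P (Z12 @^-1` (A `*` B)) = (Q A * Q B)%E).
rewrite -(Z_iid.2 t1)// -(Z_iid.2 t2)//.
(* Independence takes a set for every time; only the values at [t1] and [t2] enter the product, so
   [B] serves for all times other than [t1]. *)
pose F t := if t == t1 then A else B.
have := Z_iid.1 [:: t1; t2] F.
rewrite /= inE t12 => /(_ isT); rewrite big_cons big_seq1 /F eqxx.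
rewrite eq_sym (negPf t12) => <-; last by move=> t; case: ifP.
congr (P _); apply/seteqP; split => w /=.
  case=> Aw Bw t; rewrite /= !inE => /orP[] /eqP ->; first by rewrite eqxx.
  by rewrite eq_sym (negPf t12).
move=> H; split.
  by have := H t1; rewrite /= !inE eqxx/=; apply.
by have := H t2; rewrite /= !inE eqxx orbT/= eq_sym (negPf t12); apply.
Qed.

(** The pair [(Z t1, Z t2)] has law [Q \x Q], so the product formula pulls back to [P]. *)
Lemma iid_integrableM_comp t1 t2 (f g : T' -> R) : t1 != t2 ->
  Q.-integrable setT (EFin \o f) -> Q.-integrable setT (EFin \o g) ->
  P.-integrable setT (EFin \o (fun w => f (Z t1 w) * g (Z t2 w))) /\
  \int[P]_w (f (Z t1 w) * g (Z t2 w)) = \int[Q]_x f x * \int[Q]_x g x.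
Proof.
move=> t12 If Ig; have [Ifg fgE] := RintegralM_prod If Ig.
have mZ : measurable_fun setT (fun w => (Z t1 w, Z t2 w)).
  by apply/measurable_fun_pairP; split => //=.
pose Z12 : {RV P >-> (T' * T')%type} := mfun_Sub (mem_set mZ).
pose m : probability (T' * T')%type R := distribution P Z12.
have mE (h : T' * T' -> \bar R) : (\int[m]_x h x = \int[(Q \x Q)%E]_x h x)%E.
  apply: eq_measure_integral => A mA _; exact: (esym (pair_law t12 mA)).
have mfg : measurable_fun setT (EFin \o (fun xy : T' * T' => f xy.1 * g xy.2)).
  exact: measurable_int Ifg.
have Ifg' : P.-integrable setT (EFin \o (fun w => f (Z t1 w) * g (Z t2 w))).
  apply/integrableP; split.
    exact: (measurableT_comp mfg mZ).
  have /integrableP[_ ] := Ifg; rewrite -mE ge0_integral_pushforward//.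
  by apply: measurableT_comp.
split=> //; rewrite -fgE /Rintegral -mE integral_pushforward//.
Qed.


Lemma iid_Rintegral_sum_sqr (f : T' -> R) (n : nat) : measurable_fun setT f ->
  Q.-integrable setT (EFin \o (fun x => f x ^+ 2)) ->
  P.-integrable setT (EFin \o (fun w => (\sum_(t < n) f (Z t w)) ^+ 2)) /\
  \int[P]_w (\sum_(t < n) f (Z t w)) ^+ 2 =
    n%:R * (\int[Q]_x (f x - \int[Q]_y f y) ^+ 2) +
    n%:R ^+ 2 * (\int[Q]_x f x) ^+ 2.
Proof.
move=> mf If2; have If := integrable_of_sqr mf If2.
have sqrE w : (\sum_(t < n) f (Z t w)) ^+ 2 =
    \sum_(i < n) \sum_(j < n) (f (Z i w) * f (Z j w)).
  by rewrite expr2 mulr_suml; apply: eq_bigr => i _; rewrite mulr_sumr.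
pose m := \int[Q]_x f x; pose V := \int[Q]_x (f x - m) ^+ 2.
(* One formula covers both cases: on the diagonal E[f^2] = m^2 + V, off it the moment factors as
   m^2. In the double sum m^2 is counted [n ^ 2] times and V only [n] times. *)
have Iij (i j : 'I_n) :
    P.-integrable setT (EFin \o (fun w => f (Z i w) * f (Z j w))) /\
    \int[P]_w (f (Z i w) * f (Z j w)) = m ^+ 2 + (i == j)%:R * V.
  have [->|ij] := eqVneq i j.
    have e : (fun w => f (Z j w) * f (Z j w)) = (fun x => f x ^+ 2) \o Z j.
      by apply/funext => w; rewrite /= expr2.
    rewrite e; split; first exact: iid_integrable_comp.
    by rewrite iid_Rintegral_comp// mul1r /V Rintegral_sqrB_mean//= addrC subrK.
  by rewrite mul0r addr0 expr2; apply: iid_integrableM_comp.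
have Ii (i : 'I_n) := @Rintegral_sum _ _ _ P setT _ (index_enum 'I_n) _ measurableT
  (fun j => (Iij i j).1).
have [] := @Rintegral_sum _ _ _ P setT _ (index_enum 'I_n) _ measurableT
  (fun i => (Ii i).1).
under eq_fun do rewrite -sqrE.
move=> I IE; split=> //; rewrite IE -/m -/V; under eq_bigr => i _.
  rewrite (Ii i).2; under eq_bigr => j _ do rewrite (Iij i j).2.
  rewrite big_split/= sumr_const card_ord -mulr_suml.
  rewrite (bigD1 i)//= eqxx big1 ?addr0 ?mul1r; last first.
    by move=> j /negPf ji; rewrite eq_sym ji.
  over.
rewrite big_split/= !sumr_const card_ord -mulrnA -(mulr_natl (m ^+ 2)) -(mulr_natl V) natrM; ring.
Qed.

End iid.

(** * Measurability of the feedback-modeling score *)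

Section directional_derivative.
Context {R : realType}.

(** The sequence [harmonic] tends to 0 without ever vanishing, so it may replace the
    punctured-neighbourhood limit that defines the derivative. *)
Lemma derive_cvg_harmonic (V : normedModType R) (f : V -> R) (w e : V) :
  derivable f w e ->
  (fun n => (harmonic n)^-1 * (f (harmonic n *: e + w) - f w)) @ \oo --> 'D_e f w.
Proof.
move=> dfw; have /cvgr_dnbhsP/(_ harmonic) := dfw; apply; split.
  by move=> n; rewrite gt_eqF// harmonic_gt0.
exact: cvg_harmonic.
Qed.

(* Derivability is what makes ['D_e] a limit of difference quotients along
   [1 / (n + 1)]; otherwise it is a junk value. *)
Lemma measurable_fun_derive d (T : measurableType d) (V : normedModType R)
    (F : V -> T -> R) (w e : V) :
  (forall w', measurable_fun setT (F w')) ->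
  (forall x, derivable (F ^~ x) w e) ->
  measurable_fun setT (fun x => 'D_e (F ^~ x) w).
Proof.
move=> mF dF.
apply: (measurable_fun_cvg (h := fun n x =>
  (harmonic n)^-1 * (F (harmonic n *: e + w) x - F w x))) => [n|x _].
  by apply: measurable_funM => //; exact: measurable_funB.
exact: derive_cvg_harmonic.
Qed.

End directional_derivative.

Section feedback.
Context {dX dY dC : measure_display} {X : measurableType dX}
  {Y : measurableType dY} {C : measurableType dC} {R : realType} {p d : nat}.
Variables (z : 'cV[R]_p -> X -> Y -> 'cV[R]_d) (Psi : Type)
  (u : Psi -> C -> 'cV[R]_d) (psi : Psi).
Hypothesis C_fin : finite_set [set: C].

Lemma differentiable_dotp (a : 'cV[R]_d) (f : 'cV[R]_p -> 'cV[R]_d) w :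
  differentiable f w -> differentiable (fun w' => dotp a (f w')) w.
Proof.
move=> df.
rewrite (_ : (fun _ => _) = \sum_(i < d) (fun w' => a i 0 *: (f w' i 0 : R))); last first.
  by apply/funext => w'; rewrite fct_sumE.
apply: differentiable_sum => i.
apply: differentiableZ.
apply: (@differentiable_comp _ _ _ _ f (fun M : 'cV[R]_d => M i 0 : R)) => //.
exact: differentiable_coord.
Qed.

(** Finiteness of [C] matters: with infinite support this sum would take its default value 0. The
    element [c] supplies a strictly positive term. *)
Lemma fsumr_expR_gt0 (g : C -> R) (c : C) : 0 < \sum_(c' \in [set: C]) expR (g c').
Proof.
rewrite (fsbigD1 c _ _ C_fin I) ltr_pwDl ?expR_gt0//.
rewrite fsbig_finite; last exact: sub_finite_set C_fin.
by apply: sumr_ge0 => i _; rewrite expR_ge0.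
Qed.

(** The log-softmax becomes a linear term minus a log-sum-exp, the form from which both
    differentiability and measurability are read off. *)
Lemma ln_feedback_prob w x y c : ln (feedback_prob z u psi w x y c) =
  dotp (u psi c) (z w x y) -
  ln (\sum_(c' \in [set: C]) expR (dotp (u psi c') (z w x y))).
Proof. by rewrite ln_div ?expRK// posrE ?expR_gt0 ?fsumr_expR_gt0. Qed.

Lemma differentiable_ln_feedback_prob w x y c :
  differentiable (fun w' => z w' x y) w ->
  differentiable (fun w' => ln (feedback_prob z u psi w' x y c)) w.
Proof.
move=> dz; under eq_fun do rewrite ln_feedback_prob.
apply: differentiableB; first exact: differentiable_dotp.
pose S w' := \sum_(c' \in [set: C]) expR (dotp (u psi c') (z w' x y)).
change (differentiable (@ln R \o S) w).
apply: differentiable_comp; last first.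
  apply/derivable1_diffP.
  exact: (@ex_derive _ _ _ _ _ _ _ (is_derive1_ln (fsumr_expR_gt0 _ c))).
(* The sum over [C] is turned into one over ordinals, to which [differentiable_sum] applies; [c] is
   only the default of [nth]. *)
rewrite /S; under eq_fun do rewrite fsbig_finite//= (big_nth c) big_mkord.
set s := finmap.enum_fset _.
rewrite (_ : (fun _ => _) = \sum_(i < size s)
   (fun w' => expR (dotp (u psi (nth c s i)) (z w' x y)))); last first.
  by apply/funext => w'; rewrite fct_sumE.
apply: differentiable_sum => i.
apply: (@differentiable_comp _ _ _ _ (fun w' => dotp (u psi (nth c s i)) (z w' x y)) expR).
  exact: differentiable_dotp.
exact/derivable1_diffP/derivable_expR.
Qed.

Lemma measurable_ln_feedback_prob w :
  (forall B : set C, measurable B) ->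
  (forall i, measurable_fun [set: X * Y] (fun xy => z w xy.1 xy.2 i 0)) ->
  measurable_fun setT
    (fun xyc : X * Y * C => ln (feedback_prob z u psi w xyc.1.1 xyc.1.2 xyc.2)).
Proof.
move=> mC mz.
have mzi i : measurable_fun setT (fun xyc : X * Y * C => z w xyc.1.1 xyc.1.2 i 0).
  exact: (measurableT_comp (mz i) measurable_fst).
under eq_fun do rewrite ln_feedback_prob.
apply: measurable_funB.
  apply: measurable_sum => i; apply: measurable_funM => //.
  (* The embedding is an arbitrary function of the critique, measurable because every subset of [C]
     is. *)
  apply: (measurableT_comp (f := fun c : C => u psi c i 0)); last exact: measurable_snd.
  by move=> _ B _; exact: mC.
apply: (measurableT_comp (@measurable_ln R)).
under eq_fun do rewrite fsbig_finite//.
apply: measurable_sum => c /=.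
apply: (measurableT_comp (f := @expR R)); first exact: measurable_expR.
by apply: measurable_sum => i; exact: measurable_funM.
Qed.

(** A finite second moment only says that the norm of the score is measurable; the moment
    computations need each coordinate to be. Each one is a partial derivative, hence a pointwise
    limit of measurable difference quotients. *)
Lemma measurable_feedback_score w i :
  (forall B : set C, measurable B) ->
  (forall w' i, measurable_fun [set: X * Y] (fun xy => z w' xy.1 xy.2 i 0)) ->
  (forall x y, differentiable (fun w' => z w' x y) w) ->
  measurable_fun setT (fun xyc => feedback_score z u psi w xyc i 0).
Proof.
move=> mC mz dz; rewrite /feedback_score /gradient; under eq_fun do rewrite mxE.
apply: (measurable_fun_derive (F := fun w' xyc =>
  ln (feedback_prob z u psi w' xyc.1.1 xyc.1.2 xyc.2))) => [w'|xyc].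
  exact: measurable_ln_feedback_prob.
by apply/diff_derivable/differentiable_ln_feedback_prob.
Qed.

End feedback.

(** * Moments of random vectors *)

Section vector_moments.
Context {d : measure_display} {T : measurableType d} {R : realType} {n : nat}.
Variable P : probability T R.
Implicit Types s : T -> 'cV[R]_n.

(** Each coordinate is bounded by the Euclidean norm, so the product is dominated by its square. *)
Lemma integrable_coordM s j k : (forall i, measurable_fun setT (fun x => s x i 0)) ->
  finite_second_moment P s ->
  P.-integrable setT (EFin \o (fun x => s x j 0 * s x k 0)).
Proof.
move=> ms s2; apply: (le_integrable measurableT _ _ s2).
  by apply/measurable_EFinP; exact: measurable_funM.
have norm_coord x i : `|s x i 0| <= norm2 (s x).
  rewrite -ler_sqr ?nnegrE ?sqrtr_ge0// norm2_sqr real_normK ?num_real//.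
  by rewrite (bigD1 i)//= lerDl sumr_ge0// => l _; rewrite sqr_ge0.
move=> x _ /=; rewrite lee_fin normrM [leRHS]ger0_norm ?sqr_ge0//.
by rewrite expr2 ler_pM.
Qed.

(** This is E|As|^2 = tr(A E[s s^T] A^T), from expanding each squared coordinate. Assuming only
    integrable products of coordinates lets it apply to [s] and to the centred [s - m] alike. *)
Lemma mxtrace_second_moment s (A : 'M[R]_n) :
  (forall j k, P.-integrable setT (EFin \o (fun x => s x j 0 * s x k 0))) ->
  (forall i, P.-integrable setT (EFin \o (fun x => ((A *m s x) i 0) ^+ 2))) /\
  \sum_(i < n) \int[P]_x ((A *m s x) i 0) ^+ 2 =
    \tr (A *m (\matrix_(j, k) \int[P]_x ((s x *m (s x)^T) j k)) *m A^T).
Proof.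
move=> Is.
pose F i j k x := A i j * A i k * (s x j 0 * s x k 0).
have IF i j k : P.-integrable setT (EFin \o F i j k).
  by apply: (eq_integrable measurableT _ _ _ (integrableZl measurableT _ (Is j k))).
have sqrE i x : ((A *m s x) i 0) ^+ 2 = \sum_(j < n) \sum_(k < n) F i j k x.
  rewrite mxE expr2 mulr_suml; apply: eq_bigr => j _; rewrite mulr_sumr.
  by apply: eq_bigr => k _; rewrite mulrACA.
have Ij i j := Rintegral_sum (index_enum 'I_n) measurableT (IF i j).
have Ii i := Rintegral_sum (index_enum 'I_n) measurableT (fun j => (Ij i j).1).
have sqrE' i : (fun x => ((A *m s x) i 0) ^+ 2) =
    (fun x => \sum_(j < n) \sum_(k < n) F i j k x).
  by apply/funext => x; exact: sqrE.
split=> [i|]; first by rewrite sqrE'; exact: (Ii i).1.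
apply: eq_bigr => i _; rewrite sqrE' (Ii i).2 mxE.
under eq_bigr do rewrite (Ij i _).2.
(* The diagonal of [A *m _ *m A^T] has the sum over [k] outermost. *)
rewrite exchange_big/=; apply: eq_bigr => k _; rewrite !mxE mulr_suml.
apply: eq_bigr => j _; rewrite !mxE RintegralZl//.
rewrite mulrAC; congr (_ * _ * _).
by apply: eq_Rintegral => x _; rewrite mxE big_ord1 mxE.
Qed.

Lemma mean_vector_mulmx s (A : 'M[R]_n) i :
  (forall j, P.-integrable setT (EFin \o (fun x => s x j 0))) ->
  \int[P]_x ((A *m s x) i 0) = (A *m mean_vector P s) i 0.
Proof.
move=> Is; under eq_Rintegral do rewrite mxE.
have IA j : P.-integrable setT (EFin \o (fun x => A i j * s x j 0)).
  by apply: (eq_integrable measurableT _ _ _ (integrableZl measurableT _ (Is j))).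
rewrite (Rintegral_sum (index_enum 'I_n) measurableT IA).2 mxE.
by apply: eq_bigr => j _; rewrite RintegralZl// mxE.
Qed.

Lemma integrable_centeredM (f g : T -> R) (a b : R) :
  P.-integrable setT (EFin \o f) -> P.-integrable setT (EFin \o g) ->
  P.-integrable setT (EFin \o (fun x => f x * g x)) ->
  P.-integrable setT (EFin \o (fun x => (f x - a) * (g x - b))).
Proof.
move=> If Ig Ifg.
have Ibf := integrableZl measurableT (- b) If.
have Iag := integrableZl measurableT (- a) Ig.
have Ic := integrable_cst_probability P (a * b).
apply: (eq_integrable measurableT _ _ _ (integrableD measurableT
  (integrableD measurableT Ifg Ibf) (integrableD measurableT Iag Ic))).
by move=> x _ /=; rewrite -!EFinM -!EFinD; congr EFin; ring.
Qed.

End vector_moments.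

(** * Mean squared displacement of the iterates *)

Lemma iterates_sum (S : Type) (R : realType) (p : nat) (a : R)
    (s : S -> 'cV[R]_p) (w0 : 'cV[R]_p) (zeta : nat -> S) (t : nat) :
  iterates a s w0 zeta t - w0 = a *: \sum_(i < t) s (zeta i).
Proof.
elim: t => [|t IHt] /=; first by rewrite subrr big_ord0 scaler0.
by rewrite big_ord_recr/= scalerDr -IHt addrAC.
Qed.

Lemma expectation_norm2_sqr_iid_sum d d' (T : measurableType d)
    (T' : measurableType d') (R : realType) (n : nat) (P : probability T R)
    (Z : nat -> {RV P >-> T'}) (Q : probability T' R) (s : T' -> 'cV[R]_n)
    (A : 'M[R]_n) (a : R) (N : nat) :
  iid Z Q -> (forall i, measurable_fun setT (fun x => s x i 0)) ->
  finite_second_moment Q s ->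
  ('E_P[fun w => (norm2 (A *m (a *: \sum_(t < N) s (Z t w))) ^+ 2)%R])%E =
  (a ^+ 2 * (N%:R * \tr (A *m covariance_matrix Q s *m A^T) +
             N%:R ^+ 2 * norm2 (A *m mean_vector Q s) ^+ 2))%:E.
Proof.
move=> Z_iid ms s2; set m := mean_vector Q s.
have Iss j k := integrable_coordM j k ms s2.
have Is j : Q.-integrable setT (EFin \o (fun x => s x j 0)).
  by apply: integrable_of_sqr => //; under eq_fun do rewrite expr2.
have Icc j k : Q.-integrable setT
    (EFin \o (fun x => (s x - m) j 0 * (s x - m) k 0)).
  by under eq_fun do rewrite !mxE; exact: integrable_centeredM.
(* The centred version gives the value of the covariance trace; the uncentred one gives the
   square-integrability required by the scalar i.i.d. formula. *)
have [_ covE] := mxtrace_second_moment A Icc.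
have [Iq _] := mxtrace_second_moment A Iss.
have mf i : measurable_fun setT (fun x => (A *m s x) i 0).
  under eq_fun do rewrite mxE; apply: measurable_sum => j.
  by apply: measurable_funM.
have Imean i := mean_vector_mulmx A i Is.
have IS i := iid_Rintegral_sum_sqr Z_iid N (mf i) (Iq i).
have Ia i := integrableZl measurableT (a ^+ 2) (IS i).1.
have [IE EE] := Rintegral_sum (index_enum 'I_n) measurableT Ia.
have dE : (fun w => norm2 (A *m (a *: \sum_(t < N) s (Z t w))) ^+ 2) =
    fun w => \sum_(i < n) (a ^+ 2 * (\sum_(t < N) (A *m s (Z t w)) i 0) ^+ 2).
  apply/funext => w; rewrite norm2_sqr; apply: eq_bigr => i _.
  by rewrite -scalemxAr mulmx_sumr mxE summxE exprMn.
(* The expectation is extended-real; integrability makes it finite, so it can be computed as a real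
   integral. *)
rewrite dE unlock -[LHS]fineK; last exact: integrable_fin_num IE.
rewrite [X in X%:E]EE; congr (_%:E).
under eq_bigr do rewrite RintegralZl ?(IS _).2 ?(IS _).1//.
rewrite -mulr_sumr big_split/= -!mulr_sumr; congr (_ * (_ * _ + _ * _)).
  (* Centring commutes with [A]: the [i]-th coordinate of [A *m s] minus its mean is that of
     [A *m (s - m)]. *)
  rewrite -[in RHS]covE; apply: eq_bigr => i _; apply: eq_Rintegral => x _.
  by rewrite Imean mulmxBr !mxE.
by rewrite norm2_sqr; apply: eq_bigr => i _; rewrite Imean.
Qed.

Theorem theoremC2 (R : realType) (p d : nat)
  (dX dY dC : measure_display) (X : measurableType dX)
  (Y : measurableType dY) (C : measurableType dC)
  (mu : probability X R)
  (resp : X -> set Y)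
  (resp_fin : forall x, finite_set (resp x))
  (resp_neq0 : forall x, resp x !=set0)
  (C_fin : finite_set [set: C])
  (C_discrete : forall B : set C, measurable B)
  (z : 'cV[R]_p -> X -> Y -> 'cV[R]_d)
  (z_diff : forall x y w, differentiable (fun w' => z w' x y) w)
  (z_meas : forall w i,
     measurable_fun [set: X * Y] (fun xy => z w xy.1 xy.2 i 0))
  (tau : R) (tau_gt0 : 0 < tau)
  (b0 : 'cV[R]_d) (w0 : 'cV[R]_p)
  (pi0 : R.-pker X ~> Y)
  (pi0_policy : is_policy_kernel resp z tau b0 w0 pi0)
  (d0 := joint_law mu pi0)
  (pass : X -> Y -> bool)
  (succ := [set xy : X * Y | pass xy.1 xy.2])
  (succ_meas : measurable succ)
  (succ_gt0 : (0 < d0 succ)%E)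
  (sw := policy_score resp z tau b0 w0)
  (Sigma_fin : forall i j : 'I_p,
     d0.-integrable succ (fun xy => ((sw xy *m (sw xy)^T) i j)%:E))
  (Sigma := cond_second_moment d0 succ sw)
  (lam : 'I_p -> R) (v : 'I_p -> 'cV[R]_p)
  (Sigma_eigen : sorted_eigenbasis Sigma lam v)
  (eta : R) (eta_gt0 : 0 < eta)
  (Pi : 'M[R]_p)
  (Pi_proj : orthogonal_projector Pi (low_space lam v eta))
  (Psi : Type) (u : Psi -> C -> 'cV[R]_d) (psi0 : Psi)
  (M : R.-pker (X * Y)%type ~> C)
  (Q := joint_law d0 M)
  (sFM := feedback_score z u psi0 w0)
  (sFM_L2 : finite_second_moment Q sFM)
  (mFM := mean_vector Q sFM)
  (CFM := covariance_matrix Q sFM)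
  (rho lambda : R) (rho_gt0 : 0 < rho) (lambda_gt0 : 0 < lambda)
  (dO : measure_display) (Omega : measurableType dO) (P : probability Omega R)
  (xyc : nat -> {RV P >-> (X * Y * C)%type})
  (xyc_iid : iid xyc Q)
  (w := fun (t : nat) (omega : Omega) =>
     iterates (rho * lambda) sFM w0 (fun i => xyc i omega) t)
  (drift := fun (t : nat) (omega : Omega) =>
     norm2 (Pi *m (w t omega - w0)) ^+ 2)
  (k := \dim (low_space lam v eta)) :
  \tr Pi = k%:R /\
  forall T : nat, (1 <= T)%N ->
    ('E_P[drift T])%E =
      (rho ^+ 2 * lambda ^+ 2 *
        (T%:R * \tr (Pi *m CFM *m Pi) + T%:R ^+ 2 * norm2 (Pi *m mFM) ^+ 2))%:E
    /\
    forall bFM gammaFM : R, 0 < bFM -> 0 < gammaFM ->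
      bFM <= norm2 (Pi *m mFM) ->
      loewner_ge (Pi *m CFM *m Pi) (gammaFM *: Pi) ->
      ((rho ^+ 2 * lambda ^+ 2 *
         (T%:R * gammaFM * k%:R + T%:R ^+ 2 * bFM ^+ 2))%:E <= 'E_P[drift T])%E.
Proof.
have [v_on _ _ _] := Sigma_eigen.
pose s := [seq i <- enum 'I_p | lam i < eta].
have us : uniq s by rewrite filter_uniq// enum_uniq.
(* [low_space] is by conversion the span of the orthonormal family [v] over the duplicate-free list
   [s]. *)
have PiS : orthogonal_projector Pi <<[seq v i | i <- s]>>%VS := Pi_proj.
have trPi : \tr Pi = k%:R := mxtrace_orthogonal_projector_span v_on us PiS.
have PiT : Pi^T = Pi := trmx_orthogonal_projector_span v_on us PiS.
have msFM i : measurable_fun setT (fun x => sFM x i 0).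
  by apply: measurable_feedback_score.
split=> // N _.
have E : ('E_P[drift N])%E = (rho ^+ 2 * lambda ^+ 2 *
    (N%:R * \tr (Pi *m CFM *m Pi) + N%:R ^+ 2 * norm2 (Pi *m mFM) ^+ 2))%:E.
  have := expectation_norm2_sqr_iid_sum Pi (rho * lambda) N xyc_iid msFM sFM_L2.
  rewrite PiT exprMn => <-; congr (expectation _ _).
  by apply/funext => omega; rewrite /drift /w iterates_sum.
(* The trace of the positive semidefinite matrix [Pi *m CFM *m Pi - gammaFM *: Pi] is nonnegative;
   with [\tr Pi = k] this bounds the variance term below by [gammaFM * k]. *)
split=> // bFM gammaFM b_gt0 gamma_gt0 b_le /psdmx_mxtrace_ge0.
rewrite raddfB/= mxtraceZ trPi subr_ge0 => tr_ge.
rewrite E lee_fin; apply: ler_wpM2l; first by rewrite mulr_ge0 ?sqr_ge0.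
rewrite -mulrA; apply: lerD; first by rewrite ler_wpM2l.
apply: ler_wpM2l; first exact: sqr_ge0.
by rewrite ler_sqr// nnegrE ?sqrtr_ge0// ltW.
Qed.
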